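(* Let $n\ge1$, let $A=(\mathbf a_1,\dots,\mathbf a_n)$ be a real $n\times n$ matrix with columns $\mathbf a_1,\dots,\mathbf a_n$, and let $\sigma\in D_n$. Then $$\operatorname{dih}(\mathbf a_{\sigma(1)},\dots,\mathbf a_{\sigma(n)})=\operatorname{sig}(\sigma)\operatorname{dih}(A).$$
   Context: For $n\ge1$ and $k=1,\dots,n$, let $\rho_k$ be the permutation of $\{1,\dots,n\}$ with $\rho_k(1)=k,\rho_k(2)=k+1,\dots,\rho_k(n-k+1)=n,\rho_k(n-k+2)=1,\dots,\rho_k(n)=k-1$ (the ''rotations''), and let $\mu_k$ be the permutation with $\mu_k(1)=k,\mu_k(2)=k-1,\dots,\mu_k(k)=1,\mu_k(k+1)=n,\mu_k(k+2)=n-1,\dots,\mu_k(n)=k+1$ (the ''reflections''). The set $D_n=\{\rho_k,\mu_k: k=1,\dots,n\}$ is the dihedral group. Define $\operatorname{sig}(\rho_k)=1$ and $\operatorname{sig}(\mu_k)=-1$. For an $n\times n$ matrix $A=(a_{i,j})$, the dihedrant is $$\operatorname{dih}(A)=\sum_{k=1}^n\prod_{i=1}^n a_{i,\rho_k(i)}-\sum_{k=1}^n\prod_{i=1}^n a_{i,\mu_k(i)}.$$ *)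

(* Defs.v *)
From HB Require Import structures.
From mathcomp Require Import all_boot all_order all_algebra all_fingroup.
From mathcomp Require Import reals zify.

Set Implicit Arguments.
Unset Strict Implicit.
Unset Printing Implicit Defensive.

Import Order.TTheory GRing.Theory Num.Theory.
Local Open Scope ring_scope.

(* Positions and the index k are 0-based throughout: the element i : 'I_n
   stands for i + 1 in {1, ..., n}, and the index k : 'I_n for k + 1. *)

Lemma rot_subproof (n : nat) (k i : 'I_n) :
  ((if k + i < n then k + i else k + i - n) < n)%N.
Proof. by have := ltn_ord i; have := ltn_ord k; case: ifP; lia. Qed.

Definition rot_fun (n : nat) (k i : 'I_n) : 'I_n := Ordinal (rot_subproof k i).

Lemma rot_fun_inj (n : nat) (k : 'I_n) : injective (rot_fun k).
Proof.
move=> i j /(congr1 val) /= H; apply: val_inj => /=; move: H.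
by have := ltn_ord i; have := ltn_ord j; have := ltn_ord k;
   case: ifP; case: ifP; lia.
Qed.

(* One-line notation (1-based) k, k+1, ..., n, 1, ..., k-1. *)
Definition rho (n : nat) (k : 'I_n) : 'S_n := perm (@rot_fun_inj n k).

Lemma refl_subproof (n : nat) (k i : 'I_n) :
  ((if i <= k then k - i else n + k - i) < n)%N.
Proof. by have := ltn_ord i; have := ltn_ord k; case: ifP; lia. Qed.

Definition refl_fun (n : nat) (k i : 'I_n) : 'I_n :=
  Ordinal (refl_subproof k i).

Lemma refl_fun_inj (n : nat) (k : 'I_n) : injective (refl_fun k).
Proof.
move=> i j /(congr1 val) /= H; apply: val_inj => /=; move: H.
by have := ltn_ord i; have := ltn_ord j; have := ltn_ord k;
   case: ifP; case: ifP; lia.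
Qed.

(* One-line notation (1-based) k, k-1, ..., 1, n, n-1, ..., k+1. *)
Definition mu (n : nat) (k : 'I_n) : 'S_n := perm (@refl_fun_inj n k).

Definition rotations (n : nat) : {set 'S_n} := [set rho k | k : 'I_n].
Definition reflections (n : nat) : {set 'S_n} := [set mu k | k : 'I_n].
Definition dihedral (n : nat) : {set 'S_n} := rotations n :|: reflections n.

(* [is_sig s e] reads "sig(s) = e". It is a relation because for n <= 2 every
   rotation is also a reflection, so that both values are assigned to the same
   permutation; for n >= 3 it is the graph of a function on the dihedral
   group. *)
Variant is_sig (R : pzRingType) (n : nat) (s : 'S_n) : R -> Prop :=
  | SigRotation of s \in rotations n : is_sig s 1
  | SigReflection of s \in reflections n : is_sig s (-1).

Definition dih (R : comPzRingType) (n : nat) (A : 'M[R]_n) : R :=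
  \sum_(k < n) \prod_(i < n) A i (rho k i)
  - \sum_(k < n) \prod_(i < n) A i (mu k i).

(* Main.v *)
Require Import Defs.
From HB Require Import structures.
From mathcomp Require Import all_boot all_order all_algebra all_fingroup.
From mathcomp Require Import reals zify.

(** Modulo [n], [rho k i = k + i] and [mu k i = k - i]. Hence a rotation [s]
    satisfies [s \o rho k = rho (s k)] and [s \o mu k = mu (s k)], while a
    reflection [s] satisfies [s \o rho k = mu (s k)] and
    [s \o mu k = rho (s k)]. Reindexing both sums of the dihedrant along
    [k |-> s k] therefore preserves them in the first case and exchanges them in
    the second. *)

Set Implicit Arguments.
Unset Strict Implicit.
Unset Printing Implicit Defensive.

Import Order.TTheory GRing.Theory Num.Theory.
Local Open Scope ring_scope.

Lemma rho_rho (n : nat) (m k i : 'I_n) : rho m (rho k i) = rho (rho m k) i.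
Proof.
apply: val_inj; rewrite !permE /=.
(* Both sides agree modulo [n]; the bounds decide each wrap-around, leaving linear arithmetic. *)
by have := ltn_ord i; have := ltn_ord k; have := ltn_ord m;
   repeat case: ifP; lia.
Qed.

Lemma rho_mu (n : nat) (m k i : 'I_n) : rho m (mu k i) = mu (rho m k) i.
Proof.
apply: val_inj; rewrite !permE /=.
by have := ltn_ord i; have := ltn_ord k; have := ltn_ord m;
   repeat case: ifP; lia.
Qed.

Lemma mu_rho (n : nat) (m k i : 'I_n) : mu m (rho k i) = mu (mu m k) i.
Proof.
apply: val_inj; rewrite !permE /=.
by have := ltn_ord i; have := ltn_ord k; have := ltn_ord m;
   repeat case: ifP; lia.
Qed.

Lemma mu_mu (n : nat) (m k i : 'I_n) : mu m (mu k i) = rho (mu m k) i.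
Proof.
apply: val_inj; rewrite !permE /=.
by have := ltn_ord i; have := ltn_ord k; have := ltn_ord m;
   repeat case: ifP; lia.
Qed.

(** Entry [(i, j)] of [col_perm s A] is [A i (s j)], so [s] only relabels the summands. Keeping [f]
    and [g] distinct covers the exchange of [rho] and [mu]. *)
Lemma sum_prod_col_perm (R : comPzRingType) (n : nat) (A : 'M[R]_n) (s : 'S_n)
    (f g : 'I_n -> 'S_n) :
  (forall k i, s (f k i) = g (s k) i) ->
  \sum_(k < n) \prod_(i < n) col_perm s A i (f k i) =
  \sum_(k < n) \prod_(i < n) A i (g k i).
Proof.
move=> sfg; rewrite [RHS](reindex_inj (@perm_inj _ s)).
by apply: eq_bigr => k _; apply: eq_bigr => i _; rewrite mxE sfg.
Qed.

Lemma dih_col_perm_rho (R : comPzRingType) (n : nat) (A : 'M[R]_n) (m : 'I_n) :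
  dih (col_perm (rho m) A) = dih A.
Proof.
by rewrite /dih (sum_prod_col_perm A (rho_rho m))
  (sum_prod_col_perm A (rho_mu m)).
Qed.

Lemma dih_col_perm_mu (R : comPzRingType) (n : nat) (A : 'M[R]_n) (m : 'I_n) :
  dih (col_perm (mu m) A) = - dih A.
Proof.
by rewrite /dih (sum_prod_col_perm A (mu_rho m))
  (sum_prod_col_perm A (mu_mu m)) opprB.
Qed.

Theorem theorem2 (R : realType) (n : nat) (hn : (1 <= n)%N) (A : 'M[R]_n)
    (sigma : 'S_n) (hsigma : sigma \in dihedral n)
    (e : R) (he : is_sig sigma e) :
  dih (col_perm sigma A) = e * dih A.
Proof.
(* The split follows the sign [e]: for [n <= 2], [sigma] can be both a rotation and a reflection,
   and then both signs hold. *)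
case: he => /imsetP[m _ ->].
- by rewrite dih_col_perm_rho mul1r.
- by rewrite dih_col_perm_mu mulN1r.
Qed.
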